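(* Let $X_{i\ell}$, $1\le i\le n$, $1\le\ell\le L_i$, be independent random vectors. For each $1\le i\le n$, let $G_i=(V_i,E_i)$ be a graph on $V_i=\{1,\dots,L_i\}$ with maximum node degree $d_{i,\max}$, let $\{h_{i,e}\}_{e\in E_i}$ be a collection of bivariate kernels, and let $$U_2=\sum_{i=1}^n\sum_{e=(\ell,k)\in E_i}h_{i,e}(X_{i\ell},X_{ik}).$$ Suppose that for every $1\le i\le n$ and every $e=(\ell,k)\in E_i$ there exists $\sigma_{i,e}>0$ such that $$\mathbb{E}\Bigl[e^{\lambda\{h_{i,e}(X_{i\ell},X_{ik})-\mathbb{E}h_{i,e}(X_{i\ell},X_{ik})\}}\Bigr]\le e^{\lambda^2\sigma_{i,e}^2/2}\qquad\text{for all }\lambda>0.$$ Then, for all $t>0$, $$\mathbb{P}(U_2-\mathbb{E}U_2>t)\le\exp\left\{-\frac{t^2}{2\sum_{i=1}^n(d_{i,\max}+1)\sum_{e\in E_i}\sigma_{i,e}^2}\right\}.$$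
   Context: The random vectors $X_{i\ell}\in\mathbb{R}^p$ are (jointly) independent but not necessarily identically distributed, and each $L_i\ge1$ is a deterministic integer. Each $G_i$ is an arbitrary deterministic simple undirected graph, at least one of the $G_i$ has an edge, and each edge $e\in E_i$ is written as a pair $e=(\ell,k)$ in one fixed order of its endpoints. Each kernel $h_{i,e}:\mathbb{R}^p\times\mathbb{R}^p\to\mathbb{R}$ is a measurable function, which may depend on $i$ and $e$ and need not be symmetric; the expectations $\mathbb{E}h_{i,e}(X_{i\ell},X_{ik})$ are finite. *)

(* Defs.v *)
From HB Require Import structures.
From mathcomp Require Import all_boot all_order all_algebra.
From mathcomp Require Import all_classical all_reals all_analysis.

Set Implicit Arguments.
Unset Strict Implicit.
Unset Printing Implicit Defensive.

Import Order.TTheory GRing.Theory Num.Theory.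

Local Open Scope classical_set_scope.
Local Open Scope ring_scope.

Record sgraph (V : finType) := SGraph {
  adj :> rel V;
  adj_sym : symmetric adj;
  adj_irr : irreflexive adj }.

Definition max_degree (V : finType) (G : sgraph V) : nat :=
  \max_(v : V) #|[set w : V | G v w]%SET|.

(* [E] lists every undirected edge {u, v} of [G] exactly once, as one of the
   two ordered pairs (u, v), (v, u); which of the two is arbitrary. *)
Definition edge_listing (V : finType) (G : sgraph V) (E : {set V * V}) : Prop :=
  (forall e : V * V, e \in E -> G e.1 e.2) /\
  (forall u v : V, G u v -> ((u, v) \in E) (+) ((v, u) \in E)).

(* Mutual independence: the product rule for every subfamily. *)
Definition independent_RVs (d d' : measure_display) (T : measurableType d)
    (T' : measurableType d') (R : realType) (P : probability T R)
    (I : finType) (Y : I -> {RV P >-> T'}) : Prop :=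
  forall (J : {set I}) (B : I -> set T'),
    (forall i, i \in J -> measurable (B i)) ->
    P [set w | forall i, i \in J -> B i (Y i w)] =
    (\prod_(i in J) P (Y i @^-1` B i))%E.

Section edge_sum.
(* R^p is [p.-tuple R], with the product (that is, Borel) sigma-algebra. *)
Context (d : measure_display) (T : measurableType d) (R : realType)
  (P : probability T R) (p n : nat) (L : 'I_n -> nat)
  (X : forall i : 'I_n, 'I_(L i) -> {RV P >-> p.-tuple R})
  (h : forall i : 'I_n, 'I_(L i) * 'I_(L i) -> p.-tuple R -> p.-tuple R -> R).

Definition edge_term (i : 'I_n) (e : 'I_(L i) * 'I_(L i)) (w : T) : R :=
  h e (X e.1 w) (X e.2 w).

Definition U2 (E : forall i : 'I_n, {set 'I_(L i) * 'I_(L i)}) (w : T) : R :=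
  \sum_(i < n) \sum_(e in E i) edge_term e w.

End edge_sum.

(* Main.v *)
Require Import Defs.
From HB Require Import structures.
From mathcomp Require Import all_boot all_order all_algebra.
From mathcomp Require Import all_classical all_reals all_analysis.
From mathcomp Require Import measurable_realfun.
From mathcomp Require Import ring lra.

Set Implicit Arguments.
Unset Strict Implicit.
Unset Printing Implicit Defensive.

Import Order.TTheory GRing.Theory Num.Theory.
Import numFieldNormedType.Exports.

Local Open Scope classical_set_scope.
Local Open Scope ring_scope.

(** The terms of one graph are dependent through shared vertices, and the
    argument controls this by a generalized Hoelder inequality for functions
    of independent variables, due to Finner: if every coordinate i satisfies
    [\sum_(e sees i) w e <= 1], then
      [E (\prod_e G_e ^ w_e) <= \prod_e (E G_e) ^ w_e]
    for positive functions [G_e] of the independent coordinates.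

    Apply it to the disjoint union of all the graphs, the coordinates being
    the vertices and the factors being the edges.  An edge e of [G i] gets the
    weight [w_e = 1 / M_i] with [M_i = d_i + 1], and
    [G_e = exp (lambda M_i (h_e - E h_e))].  At most [d_i] edges meet at a
    vertex of [G i] ([card_incident_edges]), so the weights at a vertex add up
    to at most [d_i / (d_i + 1) <= 1].  The product on the left is
    [exp (lambda (U2 - E U2))], and the sub-Gaussian bound at [lambda M_i]
    turns the right-hand side into
    [exp (\sum_e (lambda M_i) ^ 2 sigma_e ^ 2 / (2 M_i))
       = exp (lambda ^ 2 / 2 * \sum_i M_i \sum_e sigma_e ^ 2)]
    ([edge_sum_mgf_le]).  The Chernoff bound with
    [lambda = t / \sum_i M_i \sum_e sigma_e ^ 2] ends the proof.  The
    weights [1 / (d_i + 1)] do the work of a partition of [G i] into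
    [d_i + 1] matchings.

    Finner's inequality is proved by integrating out one coordinate at a time.
    Independence says that redrawing coordinate i from its own law does not
    change the joint law ([resample_law]).  Averaging over the redrawn
    coordinate keeps each [E G_e] ([integral_avg]) and can only increase the
    expected weighted product ([weighted_prod_avg_le]); the latter is the
    usual proof of Hoelder's inequality, where the weighted inequality of
    arithmetic and geometric means is applied to the factors divided by their
    averages.  When every coordinate has been averaged all factors are
    constant and both sides agree ([finner_bounded]).  The averages and their
    logarithms make sense because the factors are kept between two positive
    constants; truncation and Fatou's lemma remove this restriction
    ([finner]). *)

(** * Resampling one of several independent variables *)

Section resampling.
Context (d d' : measure_display) (T : measurableType d) (S : measurableType d')
  (R : realType) (P : probability T R) (N : nat) (Y : 'I_N -> {RV P >-> S}).

Definition upd (x : N.-tuple S) (i : 'I_N) (y : S) : N.-tuple S :=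
  [tuple if j == i then y else tnth x j | j < N].

Lemma tnth_upd x i y j : tnth (upd x i y) j = if j == i then y else tnth x j.
Proof. by rewrite tnth_mktuple. Qed.

Lemma measurable_upd i :
  measurable_fun [set: S * N.-tuple S] (fun yx => upd yx.2 i yx.1).
Proof.
apply/measurable_fun_tnthP => j; apply: (eq_measurable_fun
  (fun yx : S * N.-tuple S => if j == i then yx.1 else tnth yx.2 j)).
  by move=> yx _ /=; rewrite tnth_upd.
case: (j == i); first exact: measurable_fst.
exact: measurableT_comp (measurable_tnth j) measurable_snd.
Qed.

Definition joint (w : T) : N.-tuple S := [tuple Y j w | j < N].

Lemma measurable_joint : measurable_fun [set: T] joint.
Proof.
apply/measurable_fun_tnthP => j; apply: (eq_measurable_fun (Y j)) => //.
by move=> w _ /=; rewrite tnth_mktuple.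
Qed.

HB.instance Definition _ :=
  isMeasurableFun.Build _ _ _ _ joint measurable_joint.

(** Boxes are the pi-system on which the joint law factorizes. *)
Definition box (B : 'I_N -> set S) : set (N.-tuple S) :=
  [set x | forall j, B j (tnth x j)].

Lemma measurable_box B : (forall j, measurable (B j)) -> measurable (box B).
Proof.
move=> mB; rewrite (_ : box B = \bigcap_(j in [set: 'I_N])
    ((fun x => tnth x j) @^-1` B j)).
  apply: fin_bigcap_measurable => // j _.
  by rewrite -[X in measurable X]setTI; exact: measurable_tnth.
by apply/seteqP; split => [x Bx j _|x Bx j]; exact: Bx.
Qed.

Lemma measurable_boxE :
  measurable = <<s [set box B | B in [set B | forall j, measurable (B j)]] >>.
Proof.
apply/seteqP; split; last first.
  apply: smallest_sub; first exact: sigma_algebra_measurable.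
  by move=> _ [B mB <-]; exact: measurable_box.
apply: smallest_sub; first exact: smallest_sigma_algebra.
rewrite -bigcup_seq => A [j _ [C mC <-]].
apply: sub_sigma_algebra; exists (fun k => if k == j then C else setT).
  by move=> k; case: ifP.
rewrite setTI; apply/seteqP; split => [x /(_ j)|x Cx k]; first by rewrite eqxx.
by case: ifP => // /eqP ->.
Qed.

Hypothesis indY : independent_RVs Y.

(** On a box, the left-hand side is the product of all the marginals by
    independence, and the right-hand side is the marginal of coordinate i times
    the joint law of the other coordinates: redrawing i erases the constraint
    that the old value of coordinate i satisfied.  Boxes determine the law. *)
Lemma resample_law i (A : set (N.-tuple S)) : measurable A ->
  distribution P joint A =
  pushforward (distribution P (Y i) \x distribution P joint)%E
    (fun yx => upd yx.2 i yx.1) A.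
Proof.
pose f := fun yx : S * N.-tuple S => upd yx.2 i yx.1.
pose mf : {mfun (S * N.-tuple S)%type >-> N.-tuple S} :=
  HB.pack f (isMeasurableFun.Build _ _ _ _ f (measurable_upd i)).
apply: (measure_unique _ (fun=> setT) measurable_boxE _ _ _
  (distribution P joint)
  (distribution (distribution P (Y i) \x distribution P joint)%E mf)).
- move=> _ _ [B mB <-] [C mC <-]; exists (fun j => B j `&` C j).
    by move=> j; exact: measurableI.
  apply/seteqP; split => x; first by move=> h; split => j; have [] := h j.
  by move=> [h h'] j; split; [exact: h|exact: h'].
- move=> _; exists (fun=> setT) => //.
  by apply/seteqP; split => x // _ j.
- by rewrite bigcup_const.
- move=> _ [B mB <-].
  have PJ (J : {set 'I_N}) : P [set w | forall j, j \in J -> B j (Y j w)] =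
      (\prod_(j in J) P (Y j @^-1` B j))%E by apply: indY => j _.
  pose B' j := if j == i then setT else B j.
  have mB' j : measurable (B' j) by rewrite /B'; case: ifP.
  transitivity (distribution P (Y i) (B i) * distribution P joint (box B'))%E;
      last first.
    rewrite -product_measure1E//; last exact: measurable_box.
    congr ((_ \x _)%E _); apply/seteqP; split => -[y x] /=.
      move=> [By B'x] j; rewrite tnth_upd; have := B'x j; rewrite /B'.
      by case: eqP => [->|].
    move=> Bu; split; first by have := Bu i; rewrite tnth_upd eqxx.
    by move=> j; rewrite /B'; have := Bu j; rewrite tnth_upd; case: eqP.
  transitivity (\prod_(j < N) P (Y j @^-1` B j))%E.
    have := PJ [set: 'I_N]%SET; rewrite (eq_bigl predT); last first.
      by move=> j; rewrite inE.
    move=> <-; congr (P _); apply/seteqP; split => w /= h j.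
      by move=> _; have := h j; rewrite tnth_mktuple.
    by rewrite tnth_mktuple; apply: h; rewrite inE.
  rewrite (bigD1 i)//=; congr (_ * _)%E.
  have := PJ [set~ i]%SET; rewrite (eq_bigl (fun j => j != i)); last first.
    by move=> j; rewrite !inE.
  move=> <-; congr (P _); apply/seteqP; split => w /= h j.
    rewrite /B' tnth_mktuple; case: eqP => // /eqP ji.
    by apply: h; rewrite !inE.
  rewrite !inE => ji; have := h j; rewrite /B' tnth_mktuple.
  by rewrite (negbTE ji).
- move=> _; rewrite /= /distribution /pushforward preimage_setT.
  by rewrite probability_setT ltry.
Qed.

Lemma integral_resample i (F : N.-tuple S -> \bar R) :
  measurable_fun [set: N.-tuple S] F -> (forall x, 0 <= F x)%E ->
  (\int[P]_w F (joint w) =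
   \int[P]_w \int[distribution P (Y i)]_y F (upd (joint w) i y))%E.
Proof.
move=> mF F0.
pose f := fun yx : S * N.-tuple S => upd yx.2 i yx.1.
pose mf : {mfun (S * N.-tuple S)%type >-> N.-tuple S} :=
  HB.pack f (isMeasurableFun.Build _ _ _ _ f (measurable_upd i)).
pose prodm := (distribution P (Y i) \x distribution P joint)%E.
have mFf : measurable_fun [set: S * N.-tuple S] (F \o f).
  exact: measurableT_comp mF (measurable_upd i).
transitivity (\int[distribution P joint]_x F x)%E.
  by rewrite ge0_integral_distribution.
transitivity (\int[distribution prodm mf]_x F x)%E.
  apply: eq_measure_integral => B mB _; exact: resample_law.
rewrite ge0_integral_distribution//.
transitivity (\int[distribution P joint]_x
    (fubini_G (distribution P (Y i)) (F \o f)) x)%E.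
  by rewrite -fubini_tonelli2 //= => -[? ?]; exact: F0.
rewrite ge0_integral_distribution//.
- by apply: measurable_fun_fubini_tonelli_G => // -[? ?]; exact: F0.
- by move=> x; apply: integral_ge0 => ? _; exact: F0.
Qed.

End resampling.

(** * The weighted inequality of arithmetic and geometric means *)

Section weighted_am_gm.
Context (R : realType) (K : finType).

(** The defect [1 - \sum w] acts as the weight of an extra factor equal to 1,
    which is what allows weights of total mass below one.  With m the
    right-hand side, it suffices to add up [ln x <= x - 1] at the points
    [r e / m] and [1 / m], with these weights. *)
Lemma weighted_am_gm (Q : pred K) (w r : K -> R) :
  (forall e, Q e -> 0 <= w e) -> \sum_(e | Q e) w e <= 1 ->
  (forall e, Q e -> 0 < r e) ->
  expR (\sum_(e | Q e) w e * ln (r e)) <=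
  1 - \sum_(e | Q e) w e + \sum_(e | Q e) w e * r e.
Proof.
move=> w0 w1 r0; set W := \sum_(e | Q e) w e; set m := (X in _ <= X).
(* If every term of the last sum vanishes then all the weights do, and m = 1. *)
have m0 : 0 < m.
  have wr0 e : Q e -> 0 <= w e * r e.
    by move=> Qe; rewrite mulr_ge0 ?w0// ltW// r0.
  have : 0 <= \sum_(e | Q e) w e * r e by exact: sumr_ge0.
  rewrite le_eqVlt => /predU1P[wr|]; last first.
    by rewrite /m; move: w1; rewrite -/W; lra.
  suff : W = 0 by rewrite /m -wr; lra.
  rewrite /W big1// => e Qe; have /eqP := esym wr.
  rewrite psumr_eq0// => /allP/(_ e).
  rewrite mem_index_enum => /(_ isT)/implyP/(_ Qe).
  by rewrite mulf_eq0 (gt_eqF (r0 _ Qe)) orbF => /eqP.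
rewrite -[leRHS]lnK ?posrE// ler_expR.
have ln_m : ln m^-1 = - ln m by rewrite lnV ?posrE.
have le1 (x : R) : 0 < x -> ln x <= x - 1.
  by move=> x0; rewrite -{1}(subrK 1 x) addrC le_ln1Dx//; lra.
have : \sum_(e | Q e) w e * ln (r e) <=
    \sum_(e | Q e) (w e * r e * m^-1 + w e * (ln m - 1)).
  apply: ler_sum => e Qe; rewrite -mulrA -mulrDr ler_wpM2l ?w0//.
  have := le1 (r e * m^-1); rewrite mulr_gt0 ?r0 ?invr_gt0// => /(_ isT).
  by rewrite lnM ?posrE ?r0 ?invr_gt0// ln_m; lra.
rewrite big_split/= -!mulr_suml -/W => /le_trans; apply.
have := le1 m^-1; rewrite invr_gt0 m0 ln_m => /(_ isT) h.
have : (1 - W) * (- ln m) <= (1 - W) * (m^-1 - 1).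
  by rewrite ler_wpM2l// subr_ge0.
have : m * m^-1 = 1 by rewrite divff ?gt_eqF.
rewrite /m -/W; set V := \sum_(e | Q e) _; set im := (_ ^-1).
nra.
Qed.

End weighted_am_gm.

(** * Finner's inequality for factors bounded away from zero and infinity *)

Section finner.
Context (d d' : measure_display) (T : measurableType d) (S : measurableType d')
  (R : realType) (P : probability T R) (N : nat) (Y : 'I_N -> {RV P >-> S}).
Hypothesis indY : independent_RVs Y.

(** The class of factors on which averages are finite and logarithms and
    quotients are harmless; averaging preserves it. *)
Definition bounded_pos (F : N.-tuple S -> R) : Prop :=
  measurable_fun [set: N.-tuple S] F /\
  exists a b, 0 < a /\ forall x, a <= F x <= b.

Definition depends_on (F : N.-tuple S -> R) (D : {set 'I_N}) : Prop :=
  forall x x', (forall j, j \in D -> tnth x j = tnth x' j) -> F x = F x'.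

(** The conditional expectation of [F (joint Y)] given all the coordinates but
    the i-th, as a function on the space of values. *)
Definition avg i (F : N.-tuple S -> R) x : R :=
  fine (\int[distribution P (Y i)]_y (F (upd x i y))%:E).

Lemma measurable_updr (x : N.-tuple S) i : measurable_fun [set: S] (upd x i).
Proof.
apply: (measurableT_comp (measurable_upd i) (g := fun y => (y, x))).
exact: measurable_fun_pair.
Qed.

Lemma measurable_slice (F : N.-tuple S -> R) x i :
  measurable_fun [set: N.-tuple S] F ->
  measurable_fun [set: S] (fun y => (F (upd x i y))%:E).
Proof.
move=> mF; apply/measurable_EFinP.
exact: measurableT_comp mF (measurable_updr x i).
Qed.

Lemma probability_mean_bounds d0 (S0 : measurableType d0)
    (mu : probability S0 R) (f : S0 -> R) (a b : R) :
  measurable_fun [set: S0] f -> 0 <= a -> (forall y, a <= f y <= b) ->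
  (a%:E <= \int[mu]_y (f y)%:E <= b%:E)%E.
Proof.
move=> mf a0 fab; apply/andP; split.
  rewrite -[leLHS]mule1 -(probability_setT mu) -integral_cst//.
  apply: ge0_le_integral => //; first exact/measurable_EFinP.
  by move=> y _; rewrite lee_fin; have /andP[] := fab y.
rewrite -[leRHS]mule1 -(probability_setT mu) -integral_cst//.
apply: ge0_le_integral => //; first 2 last.
- by move=> y _; rewrite lee_fin; have /andP[] := fab y.
- by move=> y _; rewrite lee_fin; have /andP[/(le_trans a0)] := fab y.
- exact/measurable_EFinP.
Qed.

Lemma avg_bounds i (F : N.-tuple S -> R) (a b : R) x :
  measurable_fun [set: N.-tuple S] F -> 0 <= a ->
  (forall x, a <= F x <= b) ->
  (avg i F x)%:E = (\int[distribution P (Y i)]_y (F (upd x i y))%:E)%E /\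
  a <= avg i F x <= b.
Proof.
move=> mF a0 Fab.
have /andP[h1 h2] : (a%:E <= \int[distribution P (Y i)]_y (F (upd x i y))%:E
    <= b%:E)%E.
  apply: probability_mean_bounds => //.
  by apply/measurable_EFinP; exact: measurable_slice.
have E : (avg i F x)%:E =
    (\int[distribution P (Y i)]_y (F (upd x i y))%:E)%E.
  rewrite fineK// fin_numElt (lt_le_trans _ h1) ?ltNyr//=.
  by rewrite (le_lt_trans h2) ?ltry.
by split => //; rewrite -!lee_fin E h1.
Qed.

Lemma avgE i F x : bounded_pos F ->
  (avg i F x)%:E = (\int[distribution P (Y i)]_y (F (upd x i y))%:E)%E.
Proof.
by move=> [mF [a [b [a0 Fab]]]]; have [] := avg_bounds i x mF (ltW a0) Fab.
Qed.

Lemma bounded_pos_avg i F : bounded_pos F -> bounded_pos (avg i F).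
Proof.
move=> tF; have [mF [a [b [a0 Fab]]]] := tF; split; last first.
  by exists a, b; split => // x; have [] := avg_bounds i x mF (ltW a0) Fab.
apply/measurable_EFinP.
apply: (eq_measurable_fun (fubini_G (distribution P (Y i))
  (fun yx : S * N.-tuple S => (F (upd yx.2 i yx.1))%:E))).
  by move=> x _; rewrite /= avgE.
apply: measurable_fun_fubini_tonelli_G => /=.
  apply/measurable_EFinP; exact: measurableT_comp mF (measurable_upd i).
move=> yx; rewrite lee_fin; have /andP[h _] := Fab (upd yx.2 i yx.1).
by rewrite (le_trans _ h)// ltW.
Qed.

Lemma bounded_pos_gt0 F x : bounded_pos F -> 0 < F x.
Proof. by move=> [_ [a [b [a0 /(_ x)/andP[+ _]]]]]; exact: lt_le_trans. Qed.

Lemma integral_avg i (F : N.-tuple S -> R) : bounded_pos F ->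
  (\int[P]_w (avg i F (joint Y w))%:E = \int[P]_w (F (joint Y w))%:E)%E.
Proof.
move=> tF; rewrite [RHS](integral_resample indY i (F := EFin \o F)) /=.
- by apply: eq_integral => w _; rewrite avgE.
- by apply/measurable_EFinP; case: tF.
- by move=> x; rewrite lee_fin ltW// bounded_pos_gt0.
Qed.

Lemma avg_indep i F (D : {set 'I_N}) x : bounded_pos F -> depends_on F D ->
  i \notin D -> avg i F x = F x.
Proof.
move=> tF FD iD; apply: EFin_inj; rewrite avgE//.
rewrite (eq_integral (cst (F x)%:E)); last first.
  move=> y _ /=; congr (_%:E); apply: FD => j jD; rewrite tnth_upd.
  by case: eqP => // ji; rewrite -ji jD in iD.
by rewrite integral_cst//= probability_setT mule1.
Qed.

Lemma depends_on_avg i F (D : {set 'I_N}) : depends_on F D ->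
  depends_on (avg i F) (D :\ i)%SET.
Proof.
move=> FD x x' xx'; congr fine; apply: eq_integral => y _; congr (_%:E).
apply: FD => j jD; rewrite !tnth_upd; case: eqVneq => // ji.
by apply: xx'; rewrite !inE ji.
Qed.

Section weighted_product.
Context (K : finType) (Q : pred K) (w : K -> R).
Hypothesis w0 : forall e, Q e -> 0 <= w e.

Definition weighted_prod (G : K -> N.-tuple S -> R) x : R :=
  expR (\sum_(e | Q e) w e * ln (G e x)).

Lemma measurable_weighted_prod G :
  (forall e, Q e -> measurable_fun [set: N.-tuple S] (G e)) ->
  measurable_fun [set: N.-tuple S] (weighted_prod G).
Proof.
move=> mG; apply: measurableT_comp; first exact: measurable_expR.
under eq_fun do rewrite big_mkcond.
apply: measurable_sum => e; have [Qe|//] := boolP (Q e).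
apply: measurable_funM => //; apply: measurableT_comp (mG _ Qe).
exact: measurable_ln.
Qed.

(** Hoelder's inequality in the variable y, all the other coordinates being
    fixed.  Only the factors that see coordinate i vary with y, so only their
    weights have to add up to at most one.  Divide each of them by its average
    and bound the resulting weighted product by [weighted_am_gm]: every quotient
    integrates to 1, hence so does the bound. *)
Lemma slice_weighted_prod_le i (G : K -> N.-tuple S -> R)
    (D : K -> {set 'I_N}) (x : N.-tuple S) :
  (forall e, Q e -> bounded_pos (G e)) ->
  (forall e, Q e -> depends_on (G e) (D e)) ->
  \sum_(e | Q e && (i \in D e)) w e <= 1 ->
  (\int[distribution P (Y i)]_y (weighted_prod G (upd x i y))%:E <=
   (weighted_prod (fun e => avg i (G e)) x)%:E)%E.
Proof.
move=> tG GD w1.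
pose A e := avg i (G e) x; pose C := weighted_prod (fun e => avg i (G e)) x.
have A0 e : Q e -> 0 < A e.
  by move=> Qe; exact/bounded_pos_gt0/bounded_pos_avg/tG.
pose Q' e := Q e && (i \in D e).
have Q'Q e : Q' e -> Q e by case/andP.
have wA0 e : Q' e -> 0 <= w e / A e.
  by move=> /Q'Q Qe; rewrite divr_ge0 ?w0// ltW ?A0.
have G0 e y : Q e -> 0 < G e y by move=> Qe; exact/bounded_pos_gt0/tG.
set W := \sum_(e | _) _ in w1.
have le_y y : weighted_prod G (upd x i y) <=
    C * (1 - W + \sum_(e | Q' e) w e / A e * G e (upd x i y)).
  have -> : weighted_prod G (upd x i y) =
      C * expR (\sum_(e | Q' e) w e * ln (G e (upd x i y) / A e)).
    rewrite -expRD; congr expR.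
    rewrite (bigID (fun e => i \in D e))/=.
    rewrite [X in _ = X + _](bigID (fun e => i \in D e))/=.
    rewrite addrAC -big_split/=; congr (_ + _).
      apply: eq_bigr => e /andP[Qe _].
      by rewrite ln_div ?posrE ?A0 ?G0//; ring.
    apply: eq_bigr => e /andP[Qe iD].
    rewrite (avg_indep (D := D e))//; [|exact: tG|exact: GD].
    congr (_ * ln _); apply: GD => // j jD; rewrite tnth_upd.
    by case: eqP => // ji; rewrite -ji jD in iD.
  rewrite ler_wpM2l ?expR_ge0//.
  apply: le_trans (weighted_am_gm (w := w) _ w1 _) _.
  - by move=> e /Q'Q; exact: w0.
  - by move=> e /Q'Q Qe; rewrite divr_gt0 ?G0 ?A0.
  - by rewrite lerD2l ler_sum// => e _; rewrite mulrA mulrAC.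
have mslice e : Q e -> measurable_fun [set: S] (fun y => (G e (upd x i y))%:E).
  by move=> Qe; apply: measurable_slice; have [] := tG _ Qe.
apply: le_trans (ge0_le_integral _ measurableT _ _ _
    (f2 := fun y => (C%:E * ((1 - W)%:E +
      \sum_(e | Q' e) ((w e / A e)%:E * (G e (upd x i y))%:E)))%E) _) _.
- by move=> y _; rewrite lee_fin expR_ge0.
- apply: measurable_slice; apply: measurable_weighted_prod => e Qe.
  by have [] := tG _ Qe.
- apply: measurable_funeM; apply: emeasurable_funD => //.
  under eq_fun do rewrite big_mkcond.
  apply: emeasurable_sum => e; have [/Q'Q Qe|//] := boolP (Q' e).
  exact/measurable_funeM/mslice.
- move=> y _; under eq_bigr do rewrite -EFinM.
  by rewrite sumEFin -EFinD -EFinM lee_fin.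
have mterm e : Q' e -> measurable_fun [set: S]
    (fun y => (w e / A e)%:E * (G e (upd x i y))%:E)%E.
  by move=> /Q'Q Qe; exact/measurable_funeM/mslice.
have term0 e y : Q' e -> (0 <= (w e / A e)%:E * (G e (upd x i y))%:E)%E.
  by move=> Qe; rewrite mule_ge0// lee_fin ?wA0// ltW// G0// Q'Q.
have msum : measurable_fun [set: S]
    (fun y => \sum_(e | Q' e) (w e / A e)%:E * (G e (upd x i y))%:E)%E.
  under eq_fun do rewrite big_mkcond.
  by apply: emeasurable_sum => e; have [/mterm|//] := boolP (Q' e).
have sum0 y : (0 <= \sum_(e | Q' e) (w e / A e)%:E * (G e (upd x i y))%:E)%E.
  by apply: sume_ge0 => e; exact: term0.
rewrite ge0_integralZl//; last 3 first.
- by apply: emeasurable_funD.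
- by move=> y _; rewrite adde_ge0// lee_fin subr_ge0.
- by rewrite lee_fin expR_ge0.
rewrite ge0_integralD//; last by move=> y _; rewrite lee_fin subr_ge0.
rewrite integral_cst//= probability_setT mule1.
rewrite -[X in (_ * (_ + X))%E]/(\int[distribution P (Y i)]_y
  (\sum_(e <- index_enum K | Q' e) (w e / A e)%:E * (G e (upd x i y))%:E))%E.
have -> : (\int[distribution P (Y i)]_y
    (\sum_(e | Q' e) (w e / A e)%:E * (G e (upd x i y))%:E) = W%:E)%E.
  under eq_integral do rewrite big_mkcond.
  rewrite ge0_integral_sum//; last 2 first.
  - by move=> e; have [/mterm|//] := boolP (Q' e).
  - by move=> e y _; have [/term0|//] := boolP (Q' e).
  rewrite /W -sumEFin [RHS]big_mkcond; apply: eq_bigr => e _.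
  rewrite -/(Q' e); have [Qe|_] := boolP (Q' e); last by rewrite integral0.
  rewrite ge0_integralZl//; last 3 first.
  - exact/mslice/Q'Q.
  - by move=> y _; rewrite lee_fin ltW// G0// Q'Q.
  - by rewrite lee_fin wA0.
  rewrite -avgE; last exact/tG/Q'Q.
  by rewrite -EFinM divfK// gt_eqF// A0// Q'Q.
by rewrite -EFinD subrK mule1.
Qed.

Lemma weighted_prod_avg_le i (G : K -> N.-tuple S -> R) (D : K -> {set 'I_N}) :
  (forall e, Q e -> bounded_pos (G e)) ->
  (forall e, Q e -> depends_on (G e) (D e)) ->
  \sum_(e | Q e && (i \in D e)) w e <= 1 ->
  (\int[P]_w (weighted_prod G (joint Y w))%:E <=
   \int[P]_w (weighted_prod (fun e => avg i (G e)) (joint Y w))%:E)%E.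
Proof.
move=> tG GD w1.
have mgm G' : (forall e, Q e -> bounded_pos (G' e)) ->
    measurable_fun [set: N.-tuple S] (EFin \o weighted_prod G').
  move=> tG'; apply/measurable_EFinP; apply: measurable_weighted_prod => e Qe.
  by have [] := tG' _ Qe.
rewrite (integral_resample indY i (F := EFin \o weighted_prod G)); last 2 first.
- exact: mgm.
- by move=> x; rewrite lee_fin expR_ge0.
apply: ge0_le_integral => //.
- by move=> z _; apply: integral_ge0 => y _; rewrite lee_fin expR_ge0.
- apply: (measurableT_comp (f := fubini_G (distribution P (Y i))
    (fun yx : S * N.-tuple S => (weighted_prod G (upd yx.2 i yx.1))%:E))
    _ (measurable_joint Y)).
  apply: measurable_fun_fubini_tonelli_G.
    exact: measurableT_comp (mgm _ tG) (measurable_upd i).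
  by move=> yx; rewrite lee_fin expR_ge0.
- apply: (measurableT_comp (f := EFin \o weighted_prod (fun e => avg i (G e)))
    _ (measurable_joint Y)).
  by apply: mgm => e Qe; exact/bounded_pos_avg/tG.
- by move=> z _; exact: slice_weighted_prod_le tG GD w1.
Qed.

(** Induction on the list s of the coordinates that the factors may still
    depend on. *)
Lemma finner_bounded (s : seq 'I_N) (G : K -> N.-tuple S -> R)
    (D : K -> {set 'I_N}) :
  (forall e, Q e -> bounded_pos (G e)) ->
  (forall e, Q e -> depends_on (G e) (D e)) ->
  (forall e, Q e -> {subset D e <= s}) ->
  (forall i, \sum_(e | Q e && (i \in D e)) w e <= 1) ->
  (\int[P]_z (weighted_prod G (joint Y z))%:E <=
   (expR (\sum_(e | Q e)
      w e * ln (fine (\int[P]_z (G e (joint Y z))%:E))))%:E)%E.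
Proof.
elim: s G D => [|i s IH] G D tG GD Ds w1.
  pose x0 := joint Y point.
  have GE e x : Q e -> G e x = G e x0.
    by move=> Qe; apply: GD => // j /(Ds _ Qe).
  have -> : (\int[P]_z (weighted_prod G (joint Y z))%:E)%E =
      (weighted_prod G x0)%:E.
    rewrite (eq_integral (cst (weighted_prod G x0)%:E)); last first.
      move=> z _ /=; congr (expR _)%:E; apply: eq_bigr => e Qe.
      by rewrite GE.
    by rewrite integral_cst//= probability_setT mule1.
  rewrite lee_fin ler_expR ler_sum// => e Qe.
  rewrite (eq_integral (cst (G e x0)%:E)); last by move=> z _; rewrite GE.
  by rewrite integral_cst//= probability_setT mule1.
apply: le_trans (weighted_prod_avg_le tG GD (w1 i)) _.
apply: le_trans (IH (fun e => avg i (G e)) (fun e => D e :\ i)%SET _ _ _ _) _.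
- by move=> e Qe; exact/bounded_pos_avg/tG.
- by move=> e Qe; exact/depends_on_avg/GD.
- move=> e Qe j; rewrite !inE => /andP[ji /(Ds _ Qe)].
  by rewrite inE (negbTE ji).
- move=> j; apply: le_trans (w1 j).
  rewrite [leRHS]big_mkcond [leLHS]big_mkcond/=.
  apply: ler_sum => e _; rewrite !inE.
  case: (boolP (Q e)) => //= Qe; case: (j \in D e); last by rewrite andbF.
  by case: ifP => //; rewrite w0.
- rewrite lee_fin ler_expR; apply: ler_sum => e Qe.
  by rewrite integral_avg//; exact: tG.
Qed.

End weighted_product.
End finner.

(** * Finner's inequality for positive factors *)

Section finner_inequality.
Context (d d' : measure_display) (T : measurableType d) (S : measurableType d')
  (R : realType) (P : probability T R) (N : nat) (Y : 'I_N -> {RV P >-> S}).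
Hypothesis indY : independent_RVs Y.
Context (K : finType) (Q : pred K) (w : K -> R) (G : K -> N.-tuple S -> R)
  (D : K -> {set 'I_N}) (C : K -> R).
Hypothesis w0 : forall e, Q e -> 0 <= w e.
Hypothesis w1 : forall i, \sum_(e | Q e && (i \in D e)) w e <= 1.
Hypothesis mG : forall e, Q e -> measurable_fun [set: N.-tuple S] (G e).
Hypothesis G0 : forall e x, Q e -> 0 < G e x.
Hypothesis GD : forall e, Q e -> depends_on (G e) (D e).
Hypothesis C0 : forall e, Q e -> 0 < C e.
Hypothesis GC : forall e, Q e ->
  (\int[P]_z (G e (joint Y z))%:E <= (C e)%:E)%E.

Let clip (k : nat) e x : R :=
  Num.min (Num.max (G e x) k.+1%:R^-1) k.+1%:R.

Let bounded_pos_clip k e : Q e -> bounded_pos (clip k e).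
Proof.
move=> Qe; split.
  apply: measurable_minr => //; apply: measurable_maxr => //; exact: mG.
have k1 : k.+1%:R^-1 <= k.+1%:R :> R.
  by rewrite (@le_trans _ _ 1) ?invf_le1 ?ler1n// ltr0n.
exists k.+1%:R^-1, k.+1%:R; split=> [|x]; first by rewrite invr_gt0.
by rewrite /clip le_min le_max lexx orbT k1 ge_min lexx orbT.
Qed.

Let integral_clip k e : Q e ->
  (\int[P]_z (clip k e (joint Y z))%:E <= (C e + k.+1%:R^-1)%:E)%E.
Proof.
move=> Qe; have mGj : measurable_fun [set: T] (EFin \o (G e \o joint Y)).
  apply/measurable_EFinP; exact: measurableT_comp (mG Qe) (measurable_joint Y).
apply: (@le_trans _ _
    (\int[P]_z ((G e (joint Y z))%:E + (k.+1%:R^-1)%:E))%E).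
  apply: ge0_le_integral => //.
  - move=> z _; rewrite lee_fin ltW//.
    exact: bounded_pos_gt0 (bounded_pos_clip k Qe).
  - apply/measurable_EFinP; apply: measurableT_comp (measurable_joint Y).
    by have [] := bounded_pos_clip k Qe.
  - exact: emeasurable_funD.
  - move=> z _; rewrite -EFinD lee_fin ge_min ge_max; apply/orP; left.
    by rewrite lerDl lerDr invr_ge0 ler0n/= ltW// G0.
rewrite ge0_integralD//; last by move=> z _; rewrite lee_fin ltW// G0.
by rewrite integral_cst//= probability_setT mule1 EFinD leeD2r//; exact: GC.
Qed.

Let mean_clip k e : Q e ->
  (0 < fine (\int[P]_z (clip k e (joint Y z))%:E)) &&
  ((\int[P]_z (clip k e (joint Y z))%:E)%E \is a fin_num).
Proof.
move=> Qe; have [mc [a [b [a0 cab]]]] := bounded_pos_clip k Qe.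
have /andP[h1 _] : (a%:E <= \int[P]_z (clip k e (joint Y z))%:E <= b%:E)%E.
  apply: probability_mean_bounds => //; last exact: ltW.
  exact: measurableT_comp mc (measurable_joint Y).
have fin : (\int[P]_z (clip k e (joint Y z))%:E)%E \is a fin_num.
  rewrite fin_numElt (lt_le_trans _ h1) ?ltNyr//=.
  by rewrite (le_lt_trans (integral_clip k Qe)) ?ltry.
by rewrite fin -lte_fin fineK// (lt_le_trans _ h1)// lte_fin a0.
Qed.

Let clip_eventually x : exists k0, forall k, (k0 <= k)%N ->
  forall e, Q e -> clip k e x = G e x.
Proof.
pose m e := maxn (Num.truncn (G e x)).+1 (Num.truncn (G e x)^-1).+1.
exists (\max_(e : K) m e)%N => k mk e Qe.
have mek : (m e <= k)%N by apply: leq_trans mk; exact: leq_bigmax.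
have lek n : (n.+1 <= k)%N -> n.+1%:R <= k.+1%:R :> R.
  by move=> nk; rewrite ler_nat (leq_trans nk).
move: mek; rewrite geq_max => /andP[/lek h1 /lek h2].
have G0x := G0 x Qe.
have h3 : k.+1%:R^-1 <= G e x.
  rewrite -[leRHS]invrK lef_pV2 ?posrE ?invr_gt0 ?ltr0n//.
  by apply: le_trans h2; exact/ltW/truncnS_gt.
have h4 : G e x <= k.+1%:R by apply: le_trans h1; exact/ltW/truncnS_gt.
by rewrite /clip max_l// min_l.
Qed.

(** The expectations are given through upper bounds [C e], which the truncated
    factors satisfy up to the lower truncation level [1 / (k + 1)]; the upper
    truncation only decreases them.  By [ln (c + x) <= ln c + x / c] this error
    costs at most [B / (k + 1)] in the exponent, and Fatou's lemma lets k go to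
    infinity. *)
Lemma finner :
  (\int[P]_z (weighted_prod Q w G (joint Y z))%:E <=
   (expR (\sum_(e | Q e) w e * ln (C e)))%:E)%E.
Proof.
pose B := \sum_(e | Q e) w e / C e.
pose A := \sum_(e | Q e) w e * ln (C e).
have le_k k : (\int[P]_z (weighted_prod Q w (clip k) (joint Y z))%:E <=
    (expR (A + B * k.+1%:R^-1))%:E)%E.
  apply: le_trans (finner_bounded indY w0 (s := enum 'I_N) (D := D) _ _ _ w1) _.
  - by move=> e; exact: bounded_pos_clip.
  - by move=> e Qe x x' xx'; rewrite /clip (GD Qe xx').
  - by move=> e Qe j _; rewrite mem_enum.
  rewrite lee_fin ler_expR /A /B mulr_suml -big_split/=; apply: ler_sum => e Qe.
  rewrite -mulrA -mulrDr ler_wpM2l ?w0//.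
  have Ck : 0 < C e + k.+1%:R^-1 by rewrite addr_gt0 ?C0 ?invr_gt0.
  apply: (@le_trans _ _ (ln (C e + k.+1%:R^-1))).
    have /andP[I0 Ifin] := mean_clip k Qe.
    by rewrite ler_ln ?posrE// -lee_fin fineK//; exact: integral_clip.
  have -> : C e + k.+1%:R^-1 = C e * (1 + (C e)^-1 * k.+1%:R^-1).
    by rewrite mulrDr mulr1 mulrA divff ?mul1r// gt_eqF// C0.
  rewrite lnM ?posrE ?C0//; last by rewrite addr_gt0// mulr_gt0// invr_gt0 ?C0.
  rewrite lerD2l le_ln1Dx// (@lt_trans _ _ 0)// ?ltrN10// mulr_gt0//.
  by rewrite invr_gt0 C0.
have mgj G' : (forall e, Q e -> measurable_fun [set: N.-tuple S] (G' e)) ->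
    measurable_fun [set: T] (fun z => (weighted_prod Q w G' (joint Y z))%:E).
  move=> mG'; apply/measurable_EFinP.
  apply: (measurableT_comp (f := weighted_prod Q w G') _ (measurable_joint Y)).
  exact: measurable_weighted_prod.
have mgk k : measurable_fun [set: T]
    (fun z => (weighted_prod Q w (clip k) (joint Y z))%:E).
  by apply: mgj => e Qe; have [] := bounded_pos_clip k Qe.
have -> : (\int[P]_z (weighted_prod Q w G (joint Y z))%:E =
    \int[P]_z limn_einf
      (fun k => (weighted_prod Q w (clip k) (joint Y z))%:E))%E.
  apply: eq_integral => z _; apply/esym.
  have [k0 clipG] := clip_eventually (joint Y z).
  have [] := @cvg_limn_einf_sup _
    (fun k => (weighted_prod Q w (clip k) (joint Y z))%:E)
    (weighted_prod Q w G (joint Y z))%:E.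
    apply: cvg_near_cst; exists k0 => // k /= k0k.
    by congr (expR _)%:E; apply: eq_bigr => e Qe; rewrite clipG.
  by [].
apply: le_trans (fatou _ measurableT mgk _) _.
  by move=> k z _; rewrite lee_fin expR_ge0.
have cv : ((expR (A + B * k.+1%:R^-1))%:E @[k --> \oo] --> (expR A)%:E)%E.
  apply: cvg_EFin; first exact: nearW.
  have cvAB : A + B * k.+1%:R^-1 @[k --> \oo] --> A.
    rewrite -[X in _ --> X]addr0; apply: cvgD; first exact: cvg_cst.
    rewrite -[X in _ --> X](mulr0 B); apply: cvgM; first exact: cvg_cst.
    exact: cvg_harmonic.
  exact: continuous_cvg (@continuous_expR R A) cvAB.
rewrite limn_einf_lim -(cvg_lim _ cv)//; apply: lee_lim.
- exact: is_cvg_einfs.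
- by apply/cvg_ex; eexists; exact: cv.
- apply: nearW => k; apply: le_trans (le_k k).
  by apply: ereal_inf_lbound; exists k => /=.
Qed.

End finner_inequality.

(** * The moment generating function of an edge sum *)

Lemma independent_RVs_reindex (d d' : measure_display) (T : measurableType d)
    (T' : measurableType d') (R : realType) (P : probability T R)
    (I J : finType) (Z : I -> {RV P >-> T'}) (f : J -> I) (g : I -> J) :
  cancel f g -> independent_RVs Z -> independent_RVs (Z \o f).
Proof.
move=> fK indZ A B mB.
have := indZ (f @: A)%SET (B \o g).
rewrite big_imset /=; last by move=> j k _ _; exact: can_inj fK j k.
move=> PA.
rewrite (eq_bigr (fun j => P (Z (f j) @^-1` B (g (f j))))%E); last first.
  by move=> j _; rewrite fK.
rewrite -PA; last by move=> _ /imsetP[j jA ->]; rewrite fK; exact: mB.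
congr (P _); apply/seteqP; split => z /= h.
  by move=> _ /imsetP[j jA ->]; rewrite fK; exact: h.
by move=> j jA; rewrite -[in B j](fK j); apply: h; exact: imset_f.
Qed.

(** The map from an incident edge to its other endpoint goes to the neighbours
    of v and is injective, because only one orientation of an edge is listed. *)
Lemma card_incident_edges (V : finType) (G : sgraph V) (E : {set V * V}) v :
  edge_listing G E ->
  (#|[set a in E | (v == a.1) || (v == a.2)]%SET| <= max_degree G)%N.
Proof.
move=> [EG GE]; pose opp (a : V * V) := if v == a.1 then a.2 else a.1.
rewrite -(card_in_imset (f := opp)).
  apply: leq_trans (leq_bigmax (F := fun v => #|[set w | G v w]%SET|) v).
  apply: subset_leq_card.
  apply/fintype.subsetP => _ /imsetP[[x y] /[!inE]/= /andP[/EG/= Gxy xyv] ->].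
  rewrite /opp/=; have [-> //|vx] := eqVneq v x.
  by move: xyv; rewrite (negbTE vx)/= => /eqP ->; rewrite adj_sym.
have no2 x y : (x, y) \in E -> (y, x) \in E -> False.
  by move=> xy yx; have := GE _ _ (EG _ xy); rewrite xy yx.
move=> [x y] [x' y'] /[!inE]/= /andP[xyE xyv] /andP[xyE' xyv']; rewrite /opp/=.
move: xyE xyv xyE' xyv'.
have [<-|vx] := eqVneq v x; have [<-|vx'] := eqVneq v x' => /=.
- by move=> _ _ _ _ ->.
- move=> vyE _ yvE /eqP vy' yx'; rewrite -yx' -vy' in yvE.
  by case: (no2 _ _ vyE yvE).
- move=> yvE /eqP vy vyE' _ xy'; rewrite xy' -vy in yvE.
  by case: (no2 _ _ vyE' yvE).
- by move=> _ /eqP <- _ /eqP <- ->.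
Qed.

Section edge_sum_mgf.
Context (d : measure_display) (T : measurableType d) (R : realType)
  (P : probability T R) (p n : nat) (L : 'I_n -> nat)
  (X : forall i : 'I_n, 'I_(L i) -> {RV P >-> p.-tuple R})
  (G : forall i : 'I_n, sgraph 'I_(L i))
  (E : forall i : 'I_n, {set 'I_(L i) * 'I_(L i)})
  (h : forall i : 'I_n, 'I_(L i) * 'I_(L i) -> p.-tuple R -> p.-tuple R -> R)
  (c sigma : forall i : 'I_n, 'I_(L i) * 'I_(L i) -> R).
Hypothesis indepX : independent_RVs
  (fun s : {i : 'I_n & 'I_(L i)} => X (tagged s)).
Hypothesis hE : forall i, edge_listing (G i) (E i).
Hypothesis mh : forall i e, e \in E i ->
  measurable_fun [set: p.-tuple R * p.-tuple R] (fun xy => h e xy.1 xy.2).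
Hypothesis mgf_le : forall i e, e \in E i -> forall lambda : R, 0 < lambda ->
  (\int[P]_w (expR (lambda * (edge_term X h e w - c e)))%:E <=
   (expR (lambda ^+ 2 * sigma e ^+ 2 / 2))%:E)%E.

Let M i : R := (max_degree (G i)).+1%:R.
Let V : finType := {i : 'I_n & 'I_(L i)}.
Let K : finType := {i : 'I_n & ('I_(L i) * 'I_(L i))%type}.
Let XX (s : V) := X (tagged s).
Let Y := XX \o (enum_val : 'I_#|V| -> V).
(* [finner] works with tuples, so the vertices of all the graphs are numbered. *)
Let vtx i (l : 'I_(L i)) : 'I_#|V| :=
  enum_rank (Tagged (fun i => 'I_(L i)) l : V).

Let tnth_joint i (l : 'I_(L i)) w : tnth (joint Y w) (vtx l) = X l w.
Proof. by rewrite tnth_mktuple /Y /= /vtx enum_rankK. Qed.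

Let Q : pred K := fun e => tagged e \in E (tag e).
Let D (e : K) : {set 'I_#|V|} := [set vtx (tagged e).1; vtx (tagged e).2]%SET.

(* The edges meeting vertex j all lie in the graph of j, so they share one
   weight and it is enough to count them. *)
Let vertex_weight (j : 'I_#|V|) :
  \sum_(e : K | Q e && (j \in D e)) (M (tag e))^-1 <= 1.
Proof.
rewrite -(sig_big_dep (fun=> true)
  (fun i a => (a \in E i) && (j \in [set vtx a.1; vtx a.2]%SET))
  (fun i _ => (M i)^-1))/=.
rewrite (bigD1 (tag (enum_val j)))//= [X in _ + X]big1 ?addr0; last first.
  move=> i ij; apply: big1 => a /andP[_]; rewrite !inE => /orP[] /eqP jE;
    by move: ij; rewrite jE enum_rankK /= eqxx.
set i := tag _; rewrite sumr_const -[leLHS]mulr_natr ler_pdivrMl ?ltr0n// mulr1.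
rewrite ler_nat; apply: leqW.
apply: leq_trans (card_incident_edges (tagged (enum_val j)) (hE i)).
apply: subset_leq_card; apply/fintype.subsetP => a.
have key (s : V) (l : 'I_(L (tag s))) :
    s = Tagged (fun i => 'I_(L i)) l -> tagged s == l.
  by case: s l => k l l' /= /eqP; rewrite eq_Tagged.
rewrite !inE => /andP[-> /=]; rewrite !inE => /orP[] /eqP jE; apply/orP.
  by left; apply: key; rewrite {1}jE enum_rankK.
by right; apply: key; rewrite {1}jE enum_rankK.
Qed.

(** The generalized Hoelder inequality costs a factor [M i] in the variance
    proxy of every edge: the mgf of an edge is evaluated at [lambda * M i],
    which contributes [M i ^ 2], and the weight [(M i)^-1] takes one factor
    back. *)
Lemma edge_sum_mgf_le (lambda : R) : 0 < lambda ->
  (\int[P]_w (expR (lambda *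
      \sum_(i < n) \sum_(e in E i) (edge_term X h e w - c e)))%:E <=
   (expR (lambda ^+ 2 / 2 *
      \sum_(i < n) (M i * \sum_(e in E i) sigma e ^+ 2)))%:E)%E.
Proof.
move=> l0.
pose F (e : K) (x : #|V|.-tuple (p.-tuple R)) : R :=
  expR (lambda * M (tag e) * (h (tagged e) (tnth x (vtx (tagged e).1))
    (tnth x (vtx (tagged e).2)) - c (tagged e))).
pose C (e : K) : R :=
  expR ((lambda * M (tag e)) ^+ 2 * sigma (tagged e) ^+ 2 / 2).
have M0 i : 0 < M i by rewrite ltr0n.
have indY : independent_RVs Y.
  exact: independent_RVs_reindex (@enum_valK V) indepX.
have Fj (e : K) z : F e (joint Y z) =
    expR (lambda * M (tag e) * (edge_term X h (tagged e) z - c (tagged e))).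
  by rewrite /F !tnth_joint.
have := @finner _ _ _ _ _ P _ Y indY K Q (fun e => (M (tag e))^-1) F D C.
have H1 e : Q e -> 0 <= (M (tag e))^-1 by rewrite invr_ge0 ltW.
move=> /(_ H1 vertex_weight).
have H2 e : Q e -> measurable_fun [set: #|V|.-tuple (p.-tuple R)] (F e).
  move=> Qe; apply: measurableT_comp; first exact: measurable_expR.
  apply: measurable_funM => //; apply: measurable_funB => //.
  apply: (measurableT_comp (mh Qe)
    (g := fun x => (tnth x (vtx (tagged e).1), tnth x (vtx (tagged e).2)))).
  by apply: measurable_fun_pair; exact: measurable_tnth.
have H3 e x : Q e -> 0 < F e x by move=> _; exact: expR_gt0.
have H4 e : Q e -> depends_on (F e) (D e).
  by move=> _ x x' xx'; rewrite /F !xx'// !inE eqxx ?orbT.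
have H5 e : Q e -> 0 < C e by move=> _; exact: expR_gt0.
have H6 e : Q e -> (\int[P]_z (F e (joint Y z))%:E <= (C e)%:E)%E.
  move=> Qe; under eq_integral do rewrite Fj.
  by apply: mgf_le => //; rewrite mulr_gt0.
move=> /(_ H2 H3 H4 H5 H6).
have -> : \sum_(e | Q e) (M (tag e))^-1 * ln (C e) = lambda ^+ 2 / 2 *
    \sum_(i < n) (M i * \sum_(e in E i) sigma e ^+ 2).
  rewrite (eq_bigr (fun e : K =>
      (lambda ^+ 2 / 2 * M (tag e)) * sigma (tagged e) ^+ 2)).
    rewrite -(sig_big_dep (fun=> true) (fun i a => a \in E i)
      (fun i a => lambda ^+ 2 / 2 * M i * sigma a ^+ 2))/=.
    by rewrite mulr_sumr; apply: eq_bigr => i _; rewrite mulrA mulr_sumr.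
  by move=> e _; rewrite /C expRK; field; rewrite gt_eqF.
under eq_integral => z _.
  rewrite /weighted_prod.
  under eq_bigr => e _ do rewrite Fj expRK mulrA (mulrC lambda) mulKf ?gt_eqF//.
  rewrite -mulr_sumr -(sig_big_dep (fun=> true) (fun i a => a \in E i)
      (fun i a => edge_term X h a z - c a))/=.
  over.
by [].
Qed.

End edge_sum_mgf.

(** * The tail bound *)

Theorem corollary9 (d : measure_display) (T : measurableType d) (R : realType)
  (P : probability T R) (p n : nat) (L : 'I_n -> nat)
  (hL : forall i : 'I_n, (1 <= L i)%N)
  (X : forall i : 'I_n, 'I_(L i) -> {RV P >-> p.-tuple R})
  (indepX : independent_RVs
     (fun s : {i : 'I_n & 'I_(L i)} => X (tag s) (tagged s)))
  (G : forall i : 'I_n, sgraph 'I_(L i))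
  (E : forall i : 'I_n, {set 'I_(L i) * 'I_(L i)})
  (hE : forall i : 'I_n, edge_listing (G i) (E i))
  (hasE : exists i : 'I_n, E i != finset.set0)
  (h : forall i : 'I_n, 'I_(L i) * 'I_(L i) -> p.-tuple R -> p.-tuple R -> R)
  (mh : forall (i : 'I_n) (e : 'I_(L i) * 'I_(L i)), e \in E i ->
     measurable_fun [set: p.-tuple R * p.-tuple R]
       (fun xy => h i e xy.1 xy.2))
  (inth : forall (i : 'I_n) (e : 'I_(L i) * 'I_(L i)), e \in E i ->
     P.-integrable [set: T] (EFin \o edge_term X h e))
  (sigma : forall i : 'I_n, 'I_(L i) * 'I_(L i) -> R)
  (sigma_gt0 : forall (i : 'I_n) (e : 'I_(L i) * 'I_(L i)), e \in E i ->
     0 < sigma i e)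
  (mgf_le : forall (i : 'I_n) (e : 'I_(L i) * 'I_(L i)), e \in E i ->
     forall lambda : R, 0 < lambda ->
     ('E_P[fun w => expR (lambda *
          (edge_term X h e w - fine 'E_P[edge_term X h e]))]
       <= (expR (lambda ^+ 2 * sigma i e ^+ 2 / 2))%:E)%E) :
  forall t : R, 0 < t ->
    (P [set w | (U2 X h E w - fine 'E_P[U2 X h E] > t)%R]
      <= (expR (- (t ^+ 2 /
            (2 * \sum_(i < n) ((max_degree (G i)).+1%:R *
                               \sum_(e in E i) sigma i e ^+ 2)))))%:E)%E.
Proof.
move=> t t0.
pose c i (e : 'I_(L i) * 'I_(L i)) : R := fine 'E_P[edge_term X h e].
pose v : R := \sum_(i < n) ((max_degree (G i)).+1%:R *
  \sum_(e in E i) sigma i e ^+ 2).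
have v0 : 0 < v.
  have [i /set0Pn[e eE]] := hasE.
  have s0 j : 0 <= (max_degree (G j)).+1%:R * \sum_(e in E j) sigma j e ^+ 2.
    by rewrite mulr_ge0// sumr_ge0// => ? _; exact: sqr_ge0.
  rewrite /v (bigD1 i)//= ltr_wpDr ?sumr_ge0// mulr_gt0//.
  rewrite (bigD1 e)//= ltr_wpDr ?exprn_gt0 ?sigma_gt0//.
  by apply: sumr_ge0 => ? _; exact: sqr_ge0.
have cE : fine 'E_P[U2 X h E] = \sum_(i < n) \sum_(e in E i) c i e.
  have intE i (e : 'I_(L i) * 'I_(L i)) : e \in E i ->
      (\int[P]_w (edge_term X h e w)%:E)%E = (c i e)%:E.
    move=> eE; rewrite /c unlock fineK//.
    exact: integrable_fin_num (inth _ _ eE).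
  have intS i : P.-integrable [set: T]
      (fun w => \sum_(e in E i) (edge_term X h e w)%:E)%E.
    by apply: integrable_sum => // e; exact: inth.
  rewrite unlock (_ : (\int[P]_w _)%E =
    (\sum_(i < n) \sum_(e in E i) c i e)%:E)//.
  under eq_integral do rewrite /U2 -sumEFin.
  under eq_integral do under eq_bigr do rewrite -sumEFin.
  rewrite integral_sum// -sumEFin; apply: eq_bigr => i _.
  under eq_integral do rewrite big_mkcond.
  rewrite integral_sum//; last first.
    move=> e; have [eE|_] := boolP (e \in E i); first exact: inth.
    exact: integrable0.
  rewrite -sumEFin [RHS]big_mkcond; apply: eq_bigr => e _.
  by have [eE|_] := boolP (e \in E i); [exact: intE|exact: integral0].
pose Z w : R := \sum_(i < n) \sum_(e in E i) (edge_term X h e w - c i e).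
have ZE w : U2 X h E w - fine 'E_P[U2 X h E] = Z w.
  rewrite cE /Z /U2 -sumrB; apply: eq_bigr => i _.
  by rewrite -sumrB.
have mZ : measurable_fun [set: T] Z.
  apply: measurable_sum => i; under eq_fun do rewrite big_mkcond.
  apply: measurable_sum => e; have [eE|//] := boolP (e \in E i).
  apply: measurable_funB => //; apply/measurable_EFinP.
  exact: measurable_int (inth _ _ eE).
pose ZZ : {RV P >-> R} := HB.pack Z (isMeasurableFun.Build _ _ _ _ Z mZ).
(* The minimizer of [lambda ^ 2 / 2 * v - lambda * t]. *)
pose lambda := t / v.
have l0 : 0 < lambda by rewrite divr_gt0.
apply: (@le_trans _ _ (P [set w | ZZ w >= t]%R)).
  apply: le_measure; rewrite ?inE.
  - rewrite -[X in measurable X]setTI.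
    have -> : [set w | U2 X h E w - fine 'E_P[U2 X h E] > t] =
        Z @^-1` `]t, +oo[.
      by apply/seteqP; split => w /=; rewrite ZE in_itv/= andbT.
    exact: (mZ measurableT _ (measurable_itv _)).
  - rewrite -[X in measurable X]setTI.
    have -> : [set w | ZZ w >= t] = Z @^-1` `[t, +oo[.
      by apply/seteqP; split => w /=; rewrite in_itv/= andbT.
    exact: (mZ measurableT _ (measurable_itv _)).
  - by move=> w /=; rewrite ZE => /ltW.
apply: le_trans (chernoff ZZ t l0) _.
have := edge_sum_mgf_le (c := c) (sigma := sigma) indepX hE mh _ l0.
have mgf i (e : 'I_(L i) * 'I_(L i)) : e \in E i ->
    forall lambda : R, 0 < lambda ->
    (\int[P]_w (expR (lambda * (edge_term X h e w - c i e)))%:E <=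
     (expR (lambda ^+ 2 * sigma i e ^+ 2 / 2))%:E)%E.
  by move=> eE r r0; have := mgf_le _ _ eE _ r0; rewrite /c unlock.
move=> /(_ mgf); rewrite -/v => le_mgf.
apply: (@le_trans _ _ ((expR (lambda ^+ 2 / 2 * v))%:E *
    (expR (- (lambda * t)))%:E)%E).
  rewrite lee_wpmul2r// ?lee_fin ?expR_ge0// /mmt_gen_fun unlock.
  rewrite (eq_integral (fun w => (expR (lambda * Z w))%:E))//.
  by move=> w _ /=; rewrite mulrC.
rewrite -EFinM -expRD lee_fin ler_expR /lambda -/v le_eqVlt; apply/orP; left.
by apply/eqP; field; rewrite gt_eqF.
Qed.
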